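(* Let $\mathbb{F}\in\{\mathbb{R},\mathbb{C},\mathbb{H}\}$. Then: (1) The Hopf map $\Phi:\mathbb{F}^2\to\mathcal{H}_2^0(\mathbb{F})$ is equivariant with respect to the $SU(2,\mathbb{F})$-actions: $\Phi(Av)=A\,\Phi(v)\,A^*$ for all $A\in SU(2,\mathbb{F})$ and $v\in\mathbb{F}^2$. (2) Via the map $\pi\circ\Phi:\mathbb{F}^2\to\mathbb{R}\oplus\mathbb{F}$, the standard action of $SU(2,\mathbb{F})$ on $\mathbb{F}^2$ induces an action on $\mathbb{R}\oplus\mathbb{F}$ by elements of $SO(1+\dim_{\mathbb{R}}\mathbb{F})$; that is, there is a group homomorphism $A\mapsto T_A$ from $SU(2,\mathbb{F})$ to $SO(\mathbb{R}\oplus\mathbb{F})=SO(1+\dim_{\mathbb{R}}\mathbb{F})$ such that $\pi\circ\Phi(Av)=T_A(\pi\circ\Phi(v))$ for all $v\in\mathbb{F}^2$.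
   Context: $SU(2,\mathbb{F})=\{A\in \mathrm{Mat}_2(\mathbb{F}):AA^*=I=A^*A,\ \det A=1\}$, where for $\mathbb{F}=\mathbb{H}$ the determinant condition is vacuous; thus $SU(2,\mathbb{R})=SO(2)$, $SU(2,\mathbb{C})=SU(2)$, $SU(2,\mathbb{H})=Sp(2)$. It acts on column vectors $\mathbb{F}^2$ by matrix multiplication (the standard action) and on $\mathcal{H}_2^0(\mathbb{F})$, the space of $2\times2$ traceless Hermitian matrices over $\mathbb{F}$, by $X\mapsto AXA^*$ (which preserves $\mathcal{H}_2^0(\mathbb{F})$). The Hopf map is $\Phi(v)=vv^*-\frac{\mathrm{tr}(vv^* )}{2}I_2$, and $\pi:\mathcal{H}_2^0(\mathbb{F})\to\mathbb{R}\oplus\mathbb{F}$ is the isomorphism $\begin{pmatrix}\lambda&\alpha\\ \overline{\alpha}&-\lambda\end{pmatrix}\mapsto(\lambda,\alpha)$. The norm on $\mathbb{R}\oplus\mathbb{F}$ is $|(\lambda,\alpha)|=\sqrt{|\lambda|^2+|\alpha|^2}$. *)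

(* Defs.v *)
From HB Require Import structures.
From mathcomp Require Import all_boot all_order all_algebra all_field.
From mathcomp Require Import complex ring lra.
From mathcomp Require Import boolp reals.

Set Implicit Arguments.
Unset Strict Implicit.
Unset Printing Implicit Defensive.

Import Order.TTheory GRing.Theory Num.Theory passmx.
Local Open Scope ring_scope.

(* A common interface for R, C and H, so that the notions below are written
   once: a finite-dimensional real algebra with its conjugation and real part.
   It is only ever used at the three instances given below. *)
HB.mixin Record isConjAlgebra (R : realType) F
    of Falgebra R F := {
  fconj : F -> F;
  fre : F -> R;
  fconj_linear : linear fconj;
  fconjM : forall x y, fconj (x * y) = fconj y * fconj x;
  fconjK : involutive fconj;
  fre_linear : scalar fre;
  fre1 : fre 1 = 1;
  freC : forall x y, fre (x * y) = fre (y * x);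
  fconj_fixed : forall x, fconj x = x -> x = (fre x)%:A;
  fre_conj_gt0 : forall x, x != 0 -> 0 < fre (x * fconj x)
}.

#[short(type="conjAlgType")]
HB.structure Definition ConjAlgebra (R : realType) :=
  { F of Falgebra R F & isConjAlgebra R F }.

Section RealInstance.
Variable R : realType.
Fact real_conj_linear : linear (idfun : R^o -> R^o). Proof. by []. Qed.
Fact real_conjM (x y : R^o) : idfun (x * y) = idfun y * idfun x :> R^o.
Proof. exact: mulrC. Qed.
Fact real_re_linear : scalar (idfun : R^o -> R). Proof. by []. Qed.
Fact real_fixed (x : R^o) : idfun x = x -> x = (idfun x : R)%:A.
Proof. by move=> _; rewrite /GRing.scale /= mulr1. Qed.
Fact real_conj_gt0 (x : R^o) : x != 0 -> 0 < (idfun (x * idfun x) : R).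
Proof. by move=> x0 /=; rewrite lt_def mulf_neq0 //= -expr2 sqr_ge0. Qed.
HB.instance Definition _ := isConjAlgebra.Build R R^o
  real_conj_linear real_conjM (fun=> erefl) real_re_linear erefl
  (fun x y => mulrC x y) real_fixed real_conj_gt0.
End RealInstance.

(* [Rcomplex R] is [R[i]] regarded as an algebra over [R]. *)
Section ComplexInstance.
Variable R : realType.
Local Notation C := (Rcomplex R).

Fact complex_scaleAr (a : R) (x y : C) : a *: (x * y) = x * (a *: y).
Proof. by rewrite mulrC scalerAl mulrC. Qed.
HB.instance Definition _ := GRing.Lalgebra_isAlgebra.Build R C complex_scaleAr.

Definition complex_row (x : C) : 'rV[R]_2 :=
  \row_i [:: complex.Re x; complex.Im x]`_i.
Fact complex_row_axiom : Vector.axiom 2 C.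
Proof.
exists complex_row.
  by move=> a [x1 x2] [y1 y2]; apply/rowP=> -[[|[|//]] ?]; rewrite !mxE.
exists (fun u : 'rV[R]_2 => Complex (u 0 0) (u 0 1) : C).
  by move=> [x1 x2]; rewrite /complex_row !mxE.
move=> u; apply/rowP=> -[[|[|//]] ?]; rewrite !mxE /=;
  by congr (u _ _); apply: val_inj.
Qed.
HB.instance Definition _ := Lmodule_hasFinDim.Build R C complex_row_axiom.

Fact complex_conj_linear : linear (@conjc R : C -> C).
Proof.
move=> a [x1 x2] [y1 y2]; apply/eqP; rewrite eq_complex /=.
by apply/andP; split; apply/eqP => /=; ring.
Qed.
Fact complex_conjM (x y : C) : conjc (x * y) = (conjc y : C) * conjc x :> C.
Proof.
case: x y => [a b] [c d]; apply/eqP; rewrite eq_complex /=.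
by apply/andP; split; apply/eqP => /=; ring.
Qed.
Fact complex_conjK : involutive (@conjc R : C -> C).
Proof. exact: conjcK. Qed.
Fact complex_re_linear : scalar (@complex.Re R : C -> R).
Proof. by move=> a [x1 x2] [y1 y2]. Qed.
Fact complex_reC (x y : C) : complex.Re (x * y) = complex.Re (y * x).
Proof. by rewrite mulrC. Qed.
Fact complex_fixed (x : C) : conjc x = x :> C -> x = (complex.Re x)%:A.
Proof.
case: x => a b [] /eqP; rewrite -subr_eq0 -opprD oppr_eq0 -mulr2n mulrn_eq0 /=.
by move=> /eqP ->; apply/eqP; rewrite eq_complex /= mulr1 mulr0 !eqxx.
Qed.
Fact complex_conj_gt0 (x : C) : x != 0 -> 0 < complex.Re (x * (conjc x : C)).
Proof.
case: x => a b; rewrite eq_complex /= => x0.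
rewrite mulrN opprK -!expr2 lt_def addr_ge0 ?sqr_ge0 // andbT.
by rewrite paddr_eq0 ?sqr_ge0 // !sqrf_eq0.
Qed.
HB.instance Definition _ := isConjAlgebra.Build R C
  complex_conj_linear complex_conjM complex_conjK complex_re_linear erefl
  complex_reC complex_fixed complex_conj_gt0.
End ComplexInstance.

(* [Quat a b c d] is a + b i + c j + d k. *)
Record quat (R : Type) := Quat { qa : R; qb : R; qc : R; qd : R }.

Section QuaternionInstance.
Variable R : realType.
Local Notation H := (quat R).

Definition quat_row (x : H) : 'rV[R]_4 := \row_i [:: qa x; qb x; qc x; qd x]`_i.
Definition row_quat (u : 'rV[R]_4) : H :=
  Quat (u 0 (inord 0)) (u 0 (inord 1)) (u 0 (inord 2)) (u 0 (inord 3)).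
Fact quat_rowK : cancel quat_row row_quat.
Proof. by case=> a b c d; rewrite /row_quat !mxE !inordK. Qed.
Fact row_quatK : cancel row_quat quat_row.
Proof.
move=> u; apply/rowP=> -[[|[|[|[|//]]]] ?]; rewrite !mxE /=;
  by congr (u _ _); apply: val_inj; rewrite /= inordK.
Qed.
HB.instance Definition _ := Choice.copy H (can_type quat_rowK).

Definition addq (x y : H) : H :=
  Quat (qa x + qa y) (qb x + qb y) (qc x + qc y) (qd x + qd y).
Definition oppq (x : H) : H := Quat (- qa x) (- qb x) (- qc x) (- qd x).
Definition scaleq (t : R) (x : H) : H :=
  Quat (t * qa x) (t * qb x) (t * qc x) (t * qd x).
Definition mulq (x y : H) : H :=
  Quat (qa x * qa y - qb x * qb y - qc x * qc y - qd x * qd y)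
       (qa x * qb y + qb x * qa y + qc x * qd y - qd x * qc y)
       (qa x * qc y - qb x * qd y + qc x * qa y + qd x * qb y)
       (qa x * qd y + qb x * qc y - qc x * qb y + qd x * qa y).
Definition conjq (x : H) : H := Quat (qa x) (- qb x) (- qc x) (- qd x).

Local Ltac quat_ring :=
  repeat (case=> ? ? ? ? || move=> ?);
  rewrite /addq /oppq /scaleq /mulq /conjq /=; congr Quat; ring.

Fact addqA : associative addq. Proof. quat_ring. Qed.
Fact addqC : commutative addq. Proof. quat_ring. Qed.
Fact add0q : left_id (Quat 0 0 0 0) addq. Proof. quat_ring. Qed.
Fact addNq : left_inverse (Quat 0 0 0 0) oppq addq. Proof. quat_ring. Qed.
HB.instance Definition _ := GRing.isZmodule.Build H addqA addqC add0q addNq.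

Fact mulqA : associative mulq. Proof. quat_ring. Qed.
Fact mul1q : left_id (Quat 1 0 0 0) mulq. Proof. quat_ring. Qed.
Fact mulq1 : right_id (Quat 1 0 0 0) mulq. Proof. quat_ring. Qed.
Fact mulqDl : left_distributive mulq addq. Proof. quat_ring. Qed.
Fact mulqDr : right_distributive mulq addq. Proof. quat_ring. Qed.
Fact oneq_neq0 : Quat 1 0 0 0 != 0 :> H.
Proof. by apply/eqP => -[] /eqP; rewrite oner_eq0. Qed.
HB.instance Definition _ :=
  GRing.Zmodule_isNzRing.Build H mulqA mul1q mulq1 mulqDl mulqDr oneq_neq0.

Fact scaleqA a b x : scaleq a (scaleq b x) = scaleq (a * b) x.
Proof. move: a b x; quat_ring. Qed.
Fact scale1q : left_id 1 scaleq. Proof. quat_ring. Qed.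
Fact scaleqDr : right_distributive scaleq addq. Proof. quat_ring. Qed.
Fact scaleqDl x a b : scaleq (a + b) x = addq (scaleq a x) (scaleq b x).
Proof. move: x a b; quat_ring. Qed.
HB.instance Definition _ :=
  GRing.Zmodule_isLmodule.Build R H scaleqA scale1q scaleqDr scaleqDl.
Fact scaleqAl (a : R) (x y : H) : a *: (x * y) = a *: x * y.
Proof.
change (scaleq a (mulq x y) = mulq (scaleq a x) y); move: a x y; quat_ring.
Qed.
HB.instance Definition _ := GRing.Lmodule_isLalgebra.Build R H scaleqAl.
Fact scaleqAr (a : R) (x y : H) : a *: (x * y) = x * (a *: y).
Proof.
change (scaleq a (mulq x y) = mulq x (scaleq a y)); move: a x y; quat_ring.
Qed.
HB.instance Definition _ := GRing.Lalgebra_isAlgebra.Build R H scaleqAr.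

Fact quat_row_axiom : Vector.axiom 4 H.
Proof.
exists quat_row; last by exists row_quat; [exact: quat_rowK|exact: row_quatK].
by move=> a x y; apply/rowP=> -[[|[|[|[|//]]]] ?]; rewrite !mxE.
Qed.
HB.instance Definition _ := Lmodule_hasFinDim.Build R H quat_row_axiom.
HB.instance Definition _ := Algebra_isFalgebra.Build R H.

Fact conjq_linear : linear conjq.
Proof.
move=> a x y; change (conjq (addq (scaleq a x) y)
  = addq (scaleq a (conjq x)) (conjq y)); move: a x y; quat_ring.
Qed.
Fact conjqM (x y : H) : conjq (x * y) = conjq y * conjq x.
Proof.
change (conjq (mulq x y) = mulq (conjq y) (conjq x)); move: x y; quat_ring.
Qed.
Fact conjqK : involutive conjq. Proof. quat_ring. Qed.
Fact qa_linear : scalar (@qa R). Proof. by []. Qed.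
Fact qaC (x y : H) : qa (x * y) = qa (y * x).
Proof. by change (qa (mulq x y) = qa (mulq y x)); rewrite /=; ring. Qed.
Fact conjq_fixed (x : H) : conjq x = x -> x = (qa x)%:A.
Proof.
case: x => a b c d; rewrite /conjq /= => -[hb hc hd].
by change (Quat a b c d = scaleq a (Quat 1 0 0 0)); congr Quat => /=; lra.
Qed.
Fact conjq_gt0 (x : H) : x != 0 -> 0 < qa (x * conjq x).
Proof.
case: x => a b c d x0.
change (0 < qa (mulq (Quat a b c d) (conjq (Quat a b c d)))).
rewrite /= !mulrN !opprK -!expr2 lt_def !addr_ge0 ?sqr_ge0 // andbT.
apply: contraNneq x0 => /eqP; rewrite !paddr_eq0 ?addr_ge0 ?sqr_ge0 // !sqrf_eq0.
by case/andP => /andP[/andP[/eqP-> /eqP->] /eqP->] /eqP->.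
Qed.
HB.instance Definition _ := isConjAlgebra.Build R H
  conjq_linear conjqM conjqK qa_linear erefl qaC conjq_fixed conjq_gt0.
End QuaternionInstance.

Inductive base := RealBase | ComplexBase | QuaternionBase.

Definition scalars (R : realType) (k : base) : conjAlgType R :=
  match k with
  | RealBase => R^o
  | ComplexBase => Rcomplex R
  | QuaternionBase => quat R
  end.

Lemma dim_scalars (R : realType) (k : base) :
  \dim {:scalars R k} =
    match k with RealBase => 1 | ComplexBase => 2 | QuaternionBase => 4 end.
Proof. by rewrite dimvf; case: k. Qed.

Section ConjAlgebraTheory.
Variables (R : realType) (F : conjAlgType R).

HB.instance Definition _ := GRing.isLinear.Build R F F _ fconj fconj_linear.
HB.instance Definition _ := GRing.isLinear.Build R F R _ fre fre_linear.

Definition fnorm (x : F) : R := Num.sqrt (fre (x * fconj x)).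

Lemma fconj1 : fconj (1 : F) = 1.
Proof. by rewrite -[LHS]mul1r -{1}[1]fconjK -fconjM mul1r fconjK. Qed.

End ConjAlgebraTheory.

Section Hermitian.
Variables (R : realType) (F : conjAlgType R).

Definition adjmx m n (A : 'M[F]_(m, n)) : 'M[F]_(n, m) := (map_mx fconj A)^T.

Lemma adjmxM m n p (A : 'M[F]_(m, n)) (B : 'M[F]_(n, p)) :
  adjmx (A *m B) = adjmx B *m adjmx A.
Proof.
apply/matrixP=> i j; rewrite !mxE linear_sum /=.
by apply: eq_bigr => l _; rewrite !mxE fconjM.
Qed.
Lemma adjmxK m n (A : 'M[F]_(m, n)) : adjmx (adjmx A) = A.
Proof. by apply/matrixP=> i j; rewrite !mxE fconjK. Qed.
Lemma adjmx1 n : adjmx (1%:M : 'M[F]_n) = 1%:M.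
Proof.
apply/matrixP=> i j; rewrite !mxE eq_sym.
by case: eqP; rewrite /= ?fconj1 ?linear0.
Qed.

(* Traceless Hermitian 2 x 2 matrices. *)
Definition herm0 (X : 'M[F]_2) : bool := (adjmx X == X) && (\tr X == 0).

Record H20 := MkH20 { H20_val :> 'M[F]_2; H20P : herm0 H20_val }.
HB.instance Definition _ := [isSub for H20_val].
HB.instance Definition _ := [Choice of H20 by <:].

Lemma trace_fixed (X : 'M[F]_2) : adjmx X = X -> \tr X = (fre (\tr X))%:A.
Proof.
move=> h; apply: fconj_fixed; rewrite -{2}h linear_sum.
by apply: eq_bigr => i _; rewrite !mxE.
Qed.

Lemma fre_traceC m n (A : 'M[F]_(m, n)) (B : 'M[F]_(n, m)) :
  fre (\tr (A *m B)) = fre (\tr (B *m A)).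
Proof.
transitivity (\sum_i \sum_j fre (A i j * B j i)).
  by rewrite linear_sum; apply: eq_bigr => i _; rewrite mxE linear_sum.
rewrite exchange_big linear_sum; apply: eq_bigr => j _.
by rewrite mxE linear_sum; apply: eq_bigr => i _; exact: freC.
Qed.

Lemma adjmx_scalar n (a : F) : adjmx (a%:M : 'M_n) = (fconj a)%:M.
Proof.
by apply/matrixP=> i j; rewrite !mxE eq_sym; case: eqP; rewrite /= ?linear0.
Qed.
Lemma adjmxB m n (A B : 'M[F]_(m, n)) : adjmx (A - B) = adjmx A - adjmx B.
Proof. by apply/matrixP=> i j; rewrite !mxE linearB. Qed.

Definition hopf_mx (v : 'cV[F]_2) : 'M[F]_2 :=
  v *m adjmx v - ((2^-1 : R) *: \tr (v *m adjmx v))%:M.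

Lemma hopf_herm0 v : herm0 (hopf_mx v).
Proof.
have h : adjmx (v *m adjmx v) = v *m adjmx v by rewrite adjmxM adjmxK.
apply/andP; split; apply/eqP; last first.
  rewrite /hopf_mx raddfB /= mxtrace_scalar scalerMnl -mulr_natr.
  by rewrite mulVf ?pnatr_eq0 // scale1r subrr.
rewrite /hopf_mx adjmxB h adjmx_scalar linearZ /=.
by rewrite (trace_fixed h) linearZ /= fconj1.
Qed.

Definition hopf (v : 'cV[F]_2) : H20 := MkH20 (hopf_herm0 v).

Definition RF : vectType R := (R^o * F)%type.

Lemma dim_RF : \dim {:RF} = (1 + \dim {:F})%N.
Proof. by rewrite !dimvf. Qed.

Definition RFnorm (w : RF) : R := Num.sqrt (`|w.1| ^+ 2 + fnorm w.2 ^+ 2).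

(* The diagonal of a Hermitian matrix is real, so [fre] loses nothing. *)
Definition hpi (X : H20) : RF := (fre (X 0 0), X 0 1).

Definition hpi_inv_mx (w : RF) : 'M[F]_2 :=
  \matrix_(i, j)
    if i == 0 then (if j == 0 then w.1%:A else w.2)
    else (if j == 0 then fconj w.2 else - w.1%:A).

Lemma fconj_real (t : R) : fconj (t%:A : F) = t%:A.
Proof. by rewrite linearZ /= fconj1. Qed.

Lemma hpi_inv_herm0 w : herm0 (hpi_inv_mx w).
Proof.
apply/andP; split; apply/eqP; last first.
  by rewrite /mxtrace big_ord_recl big_ord1 !mxE /= subrr.
apply/matrixP=> -[[|[|//]] hi] [[|[|//]] hj]; rewrite !mxE /= ?fconjK //.
  by rewrite fconj_real.
by rewrite linearN /= fconj_real.
Qed.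
Definition hpi_inv (w : RF) : H20 := MkH20 (hpi_inv_herm0 w).

Lemma hpi_invK : cancel hpi_inv hpi.
Proof.
by case=> t x; rewrite /hpi !mxE /= linearZ /= fre1 /GRing.scale /= mulr1.
Qed.

Lemma hpiK : cancel hpi hpi_inv.
Proof.
move=> X; apply: val_inj; case/andP: (H20P X) => /eqP hX /eqP tX.
have hE i j : fconj (X j i) = X i j by rewrite -[in RHS]hX !mxE.
have /eqP h1 : X (lift 0 0) (lift 0 0) == - X 0 0.
  by move/eqP: tX; rewrite /mxtrace big_ord_recl big_ord1 addrC addr_eq0.
have h0 := fconj_fixed _ (hE 0 0).
apply/matrixP=> -[[|[|//]] hi] [[|[|//]] hj]; rewrite !mxE /=.
- by rewrite -h0; congr (X _ _); apply: val_inj.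
- by congr (X _ _); apply: val_inj.
- by rewrite hE; congr (X _ _); apply: val_inj.
rewrite -h0; transitivity (X (lift 0 0) (lift 0 0)); first by rewrite h1.
by congr (X _ _); apply: val_inj.
Qed.

(* SO(R (+) F), i.e. SO(1 + dim F): the linear endomorphisms of R (+) F that
   preserve the norm and have determinant 1. The determinant does not depend on
   the basis; the group law is composition of functions. *)
Definition lfun_det (T : 'End(RF)) : R :=
  \det (mxof (vbasis {:RF}) (vbasis {:RF}) T).

Definition so_pred (T : 'End(RF)) : bool :=
  `[< forall w, RFnorm (T w) = RFnorm w >] && (lfun_det T == 1).

Record SORF := MkSORF { so_val :> 'End(RF); soP : so_pred so_val }.
HB.instance Definition _ := [isSub for so_val].
HB.instance Definition _ := [Choice of SORF by <:].

Lemma lfun_detM (S T : 'End(RF)) :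
  lfun_det (S \o T)%VF = lfun_det S * lfun_det T.
Proof. by rewrite /lfun_det (mxof_comp _ _ (vbasisP _)) det_mulmx mulrC. Qed.

Lemma lfun_det1 : lfun_det \1%VF = 1.
Proof. by rewrite /lfun_det mxof1 ?det1 // (basis_free (vbasisP _)). Qed.

Lemma lfun_det1_ker (T : 'End(RF)) : lfun_det T = 1 -> lker T == 0%VS.
Proof.
move=> hT; apply/lker0P; apply: raddf_inj => w Tw.
have U : mxof (vbasis {:RF}) (vbasis {:RF}) T \in unitmx.
  by rewrite unitmxE [\det _]hT unitr1.
have := rVof_app (vbasis {:RF}) (vbasisP {:RF}) T w.
rewrite Tw linear0 => hw.
apply/eqP; rewrite -(rVof_eq0 (vbasisP {:RF})) -[rVof _ _](mulmxK U) -hw.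
by rewrite mul0mx.
Qed.

Fact so_one_subproof : so_pred \1%VF.
Proof.
by apply/andP; split; [apply/asboolP=> w; rewrite id_lfunE | rewrite lfun_det1].
Qed.
Fact so_mul_subproof (S T : SORF) : so_pred (S \o T)%VF.
Proof.
case/andP: (soP S) => /asboolP nS /eqP dS.
case/andP: (soP T) => /asboolP nT /eqP dT.
apply/andP; split; last by rewrite lfun_detM dS dT mulr1.
by apply/asboolP=> w; rewrite comp_lfunE nS nT.
Qed.
Fact so_inv_subproof (T : SORF) : so_pred (T^-1)%VF.
Proof.
case/andP: (soP T) => /asboolP nT /eqP dT.
have K := lker0_compfV (lfun_det1_ker dT).
apply/andP; split; first apply/asboolP=> w.
  by rewrite -{2}[w](id_lfunE w) -K comp_lfunE nT.
by rewrite -lfun_det1 -K lfun_detM dT mul1r.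
Qed.
Definition so_one := MkSORF so_one_subproof.
Definition so_mul S T := MkSORF (so_mul_subproof S T).
Definition so_inv T := MkSORF (so_inv_subproof T).

Fact so_mulA : associative so_mul.
Proof. by move=> S T U; apply: val_inj; rewrite /= comp_lfunA. Qed.
Fact so_mul1 : left_id so_one so_mul.
Proof. by move=> T; apply: val_inj; rewrite /= comp_lfun1l. Qed.
Fact so_1mul : right_id so_one so_mul.
Proof. by move=> T; apply: val_inj; rewrite /= comp_lfun1r. Qed.
Fact so_mulV : left_inverse so_one so_inv so_mul.
Proof.
move=> T; apply: val_inj; case/andP: (soP T) => _ /eqP /lfun_det1_ker.
exact: lker0_compVf.
Qed.
Fact so_Vmul : right_inverse so_one so_inv so_mul.
Proof.
move=> T; apply: val_inj; case/andP: (soP T) => _ /eqP /lfun_det1_ker.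
exact: lker0_compfV.
Qed.
HB.instance Definition _ := isGroup.Build SORF
  so_mulA so_mul1 so_1mul so_mulV so_Vmul.
End Hermitian.

Section SpecialUnitary.
Variables (R : realType) (k : base).
Local Notation F := (scalars R k).

(* There is no determinant condition over the quaternions. *)
Definition det_cond (A : 'M[F]_2) : bool :=
  if k is QuaternionBase then true else \det A == 1.

Definition su2_pred (A : 'M[F]_2) : bool :=
  [&& A *m adjmx A == 1%:M, adjmx A *m A == 1%:M & det_cond A].

Record SU2 := MkSU2 { su2_val :> 'M[F]_2; su2P : su2_pred su2_val }.
HB.instance Definition _ := [isSub for su2_val].
HB.instance Definition _ := [Choice of SU2 by <:].

Lemma scalars_det1 : det_cond 1%:M.
Proof. by rewrite /det_cond; case: (k) => //; rewrite det1. Qed.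
Lemma scalars_detM (A B : 'M[F]_2) :
  det_cond A -> det_cond B -> det_cond (A *m B).
Proof.
rewrite /det_cond; move: A B; case: (k) => //= A B /eqP dA /eqP dB.
  by rewrite (@det_mulmx R^o) dA dB mulr1.
by rewrite (@det_mulmx (Rcomplex R)) dA dB mulr1.
Qed.
Lemma scalars_detV (A B : 'M[F]_2) :
  A *m B = 1%:M -> det_cond A -> det_cond B.
Proof.
rewrite /det_cond; move: A B; case: (k) => //= A B AB /eqP dA.
  by have := (@det_mulmx R^o _ A B); rewrite AB dA mul1r det1 => <-.
by have := (@det_mulmx (Rcomplex R) _ A B); rewrite AB dA mul1r det1 => <-.
Qed.

Fact su2_one_subproof : su2_pred 1%:M.
Proof. by rewrite /su2_pred adjmx1 mulmx1 eqxx scalars_det1. Qed.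
Fact su2_mul_subproof (A B : SU2) : su2_pred (A *m B).
Proof.
case/and3P: (su2P A) => /eqP A1 /eqP A2 dA.
case/and3P: (su2P B) => /eqP B1 /eqP B2 dB.
rewrite /su2_pred adjmxM; apply/and3P; split; last exact: scalars_detM.
  by rewrite mulmxA -(mulmxA _ (su2_val B)) B1 mulmx1 A1.
by rewrite mulmxA -(mulmxA _ (adjmx A)) A2 mulmx1 B2.
Qed.
Fact su2_inv_subproof (A : SU2) : su2_pred (adjmx A).
Proof.
case/and3P: (su2P A) => /eqP A1 /eqP A2 dA.
by rewrite /su2_pred adjmxK A1 A2 eqxx (scalars_detV A1).
Qed.
Definition su2_one := MkSU2 su2_one_subproof.
Definition su2_mul A B := MkSU2 (su2_mul_subproof A B).
Definition su2_inv A := MkSU2 (su2_inv_subproof A).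

Fact su2_mulA : associative su2_mul.
Proof. by move=> A B C; apply: val_inj; rewrite /= mulmxA. Qed.
Fact su2_mul1 : left_id su2_one su2_mul.
Proof. by move=> A; apply: val_inj; rewrite /= mul1mx. Qed.
Fact su2_1mul : right_id su2_one su2_mul.
Proof. by move=> A; apply: val_inj; rewrite /= mulmx1. Qed.
Fact su2_mulV : left_inverse su2_one su2_inv su2_mul.
Proof. by move=> A; apply: val_inj; case/and3P: (su2P A) => _ /eqP. Qed.
Fact su2_Vmul : right_inverse su2_one su2_inv su2_mul.
Proof. by move=> A; apply: val_inj; case/and3P: (su2P A) => /eqP. Qed.
HB.instance Definition _ := isGroup.Build SU2
  su2_mulA su2_mul1 su2_1mul su2_mulV su2_Vmul.

Definition std_act (A : SU2) (v : 'cV[F]_2) : 'cV[F]_2 := A *m v.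

Lemma conj_act_herm0 (A : SU2) (X : H20 F) : herm0 (A *m X *m adjmx A).
Proof.
case/and3P: (su2P A) => _ /eqP A2 _; case/andP: (H20P X) => /eqP hX /eqP tX.
have h : adjmx (A *m X *m adjmx A) = A *m X *m adjmx A.
  by rewrite !adjmxM adjmxK hX mulmxA.
apply/andP; split; apply/eqP => //.
by rewrite (trace_fixed h) fre_traceC mulmxA A2 mul1mx tX linear0 scale0r.
Qed.
Definition conj_act (A : SU2) (X : H20 F) : H20 F := MkH20 (conj_act_herm0 A X).
End SpecialUnitary.

(* Main.v *)
(* Conjugation by a unitary matrix A is a norm-preserving endomorphism T_A of
   R (+) F, and A |-> T_A is multiplicative. A norm-preserving endomorphism has
   determinant +1 or -1, so det T_A = 1 whenever A is the square of a unitary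
   matrix. A rotation with real entries is such a square. Over C and H every unit
   scalar is the square of a unit scalar, and every unitary matrix factors as
   diag(p, q) * (real rotation) * diag(1, z) with p, q, z unit scalars, so it is
   a product of squares; over R a matrix in SU(2) is itself a rotation. *)
Require Import Defs.
From HB Require Import structures.
From mathcomp Require Import all_boot all_order all_algebra all_field.
From mathcomp Require Import complex boolp reals.
From mathcomp Require Import ring lra.

Set Implicit Arguments.
Unset Strict Implicit.
Unset Printing Implicit Defensive.

Import Order.TTheory GRing.Theory Num.Theory.
Local Open Scope ring_scope.

(** * Polar form and square roots of unit scalars *)

Section ConjAlgebraFacts.
Variables (R : realType) (F : conjAlgType R).
Implicit Types (x y p : F) (s t : R).

Lemma fre_scalar t : fre (t%:A : F) = t.
Proof. by rewrite linearZ /= fre1 mulr1. Qed.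

Lemma scalarAM s t : s%:A * t%:A = (s * t)%:A :> F.
Proof. by rewrite -scalerAl mul1r scalerA. Qed.

Lemma fre_conj_ge0 x : 0 <= fre (x * fconj x).
Proof.
by have [->|/fre_conj_gt0/ltW//] := eqVneq x 0; rewrite mul0r linear0.
Qed.

Lemma mul_conj x : x * fconj x = (fre (x * fconj x))%:A.
Proof. by apply: fconj_fixed; rewrite fconjM fconjK. Qed.

Lemma conj_mul x : fconj x * x = (fre (x * fconj x))%:A.
Proof.
have h : fconj (fconj x * x) = fconj x * x by rewrite fconjM fconjK.
by rewrite (fconj_fixed _ h) freC.
Qed.

Lemma fnormE x : fnorm x ^+ 2 = fre (x * fconj x).
Proof. by rewrite sqr_sqrtr // fre_conj_ge0. Qed.

Lemma fnorm_eq0 x : (fnorm x == 0) = (x == 0).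
Proof.
rewrite /fnorm sqrtr_eq0; apply/idP/eqP => [|->]; last by rewrite mul0r linear0.
by apply: contraTeq => /fre_conj_gt0; rewrite ltNge.
Qed.

Definition funit x := x * fconj x = 1 /\ fconj x * x = 1.

Lemma funit_norm x : fre (x * fconj x) = 1 -> funit x.
Proof. by move=> h; split; rewrite (mul_conj, conj_mul) h scale1r. Qed.

Lemma funit1 : funit 1.
Proof. by split; rewrite fconj1 mulr1. Qed.

(** Normalize a nonzero [x]; at zero any unit serves, and 1 is chosen. *)
Lemma fpolar x : exists2 p, funit p & x = fnorm x *: p.
Proof.
have [x0|x0] := eqVneq x 0.
  exists 1; first exact: funit1.
  have /eqP-> : fnorm x == 0 by rewrite fnorm_eq0 x0.
  by rewrite scale0r x0.
have n0 : fnorm x != 0 by rewrite fnorm_eq0.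
exists ((fnorm x)^-1 *: x); last by rewrite scalerA mulfV ?scale1r.
apply: funit_norm.
rewrite linearZ /= -scalerAl -scalerAr !linearZ /= -fnormE.
by field.
Qed.

(* For p != -1 the root is (1 + p) / |1 + p|, since (1 + p)^2 = |1 + p|^2 p. *)
Lemma funit_sqrt (i : F) p : i * i = -1 -> fconj i = - i -> funit p ->
  exists2 r, funit r & p = r * r.
Proof.
move=> ii ci pu; have [p1|p1] := eqVneq (1 + p) 0.
  (* Here [p] is -1, and [i] itself is a unit root of it. *)
  exists i; first by split; rewrite ci ?mulrN ?mulNr ii opprK.
  by rewrite ii; apply/eqP; rewrite -addr_eq0 addrC p1.
have [r ru pE] := fpolar (1 + p).
have n0 : fnorm (1 + p) != 0 by rewrite fnorm_eq0.
exists r => //.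
have sq : (1 + p) * (1 + p) = (fnorm (1 + p) ^+ 2) *: p.
  have -> : (fnorm (1 + p) ^+ 2) *: p = p * (fnorm (1 + p) ^+ 2)%:A.
    by rewrite -scalerAr mulr1.
  rewrite fnormE -mul_conj linearD /= fconj1 mulrA; case: pu => pu _.
  have -> : p * (1 + p) = (1 + p) * p by rewrite mulrDl mulrDr mulr1 mul1r.
  have h : p * (1 + fconj p) = 1 + p by rewrite mulrDr mulr1 pu addrC.
  by rewrite -[RHS]mulrA h.
have : (fnorm (1 + p) ^+ 2) *: p = (fnorm (1 + p) ^+ 2) *: (r * r).
  by rewrite -sq {1 2}pE -scalerAl -scalerAr scalerA -expr2.
by move/(scalerI (expf_neq0 _ n0)).
Qed.

End ConjAlgebraFacts.

(** * Determinants of norm-preserving endomorphisms *)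

Section NormPreserving.
Variables (R : realType) (F : conjAlgType R).
Implicit Types (x y z : RF F) (t : R).

(* Twice the polarization of the squared norm; [fre] need not be invariant under
   [fconj] in a [conjAlgType], hence the symmetrized second term. *)
Definition rdot x y : R :=
  2 * (x.1 * y.1) + fre (x.2 * fconj y.2 + y.2 * fconj x.2).

Lemma rdotC x y : rdot x y = rdot y x.
Proof. by rewrite /rdot [x.1 * _]mulrC [x.2 * _ + _]addrC. Qed.

Lemma rdotDl x y z : rdot (x + y) z = rdot x z + rdot y z.
Proof.
rewrite /rdot /= [fconj (x.2 + y.2)]linearD /= !mulrDl !mulrDr.
by rewrite !linearD /=; ring.
Qed.

Lemma rdotZl t x y : rdot (t *: x) y = t * rdot x y.
Proof.
have fE (a b c d : F) :
    fre ((t *: a) * b + c * (t *: d)) = t * fre (a * b + c * d).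
  by rewrite -scalerAl -scalerAr -scalerDr linearZ.
rewrite /rdot; have -> : (t *: x).1 = t * (x.1 : R) by [].
by rewrite /= [fconj (t *: x.2)]linearZ /= fE; ring.
Qed.

Lemma rdotDr x y z : rdot x (y + z) = rdot x y + rdot x z.
Proof. by rewrite !(rdotC x) rdotDl. Qed.

Lemma rdot_suml n (u : 'I_n -> R) (e : 'I_n -> RF F) y :
  rdot (\sum_i u i *: e i) y = \sum_i u i * rdot (e i) y.
Proof.
rewrite (big_morph (fun x => rdot x y) (fun x z => rdotDl x z y) (id1 := 0)).
  by apply: eq_bigr => i _; rewrite rdotZl.
by rewrite -(scale0r (0 : RF F)) rdotZl mul0r.
Qed.

Lemma rdot_norm x : rdot x x = 2 * RFnorm x ^+ 2.
Proof.
rewrite /RFnorm sqr_sqrtr ?addr_ge0 ?sqr_ge0 // fnormE real_normK ?num_real //.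
by rewrite /rdot linearD /= expr2; ring.
Qed.

Lemma rdot_eq0 x : rdot x x = 0 -> x = 0.
Proof.
move=> /eqP; rewrite rdot_norm mulf_eq0 pnatr_eq0 /= sqrf_eq0.
rewrite /RFnorm sqrtr_eq0 => le0.
have : `|x.1| ^+ 2 + fnorm x.2 ^+ 2 == 0.
  by rewrite eq_le le0 addr_ge0 ?sqr_ge0.
rewrite paddr_eq0 ?sqr_ge0 // !sqrf_eq0 normr_eq0 fnorm_eq0.
by case: x {le0} => x1 x2 /= /andP[/eqP-> /eqP->].
Qed.

(** Polarization: after expanding at [x + y], only the cross terms remain. *)
Lemma rdot_isometry (T : 'End(RF F)) :
  (forall w, RFnorm (T w) = RFnorm w) -> forall x y, rdot (T x) (T y) = rdot x y.
Proof.
move=> nT x y.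
have dT w : rdot (T w) (T w) = rdot w w by rewrite !rdot_norm nT.
have := dT (x + y); rewrite linearD /= !rdotDl !rdotDr !dT.
by rewrite (rdotC (T y)) (rdotC y); lra.
Qed.

(* With G the Gram matrix of a basis, the matrix M of T satisfies M G M^T = G. *)
Lemma isometry_det (T : 'End(RF F)) :
  (forall w, RFnorm (T w) = RFnorm w) -> lfun_det T ^+ 2 = 1.
Proof.
move=> nT; rewrite /lfun_det.
set e := vbasis _; have eb : basis_of {:RF F} e by exact: vbasisP.
set M := passmx.mxof e e T.
pose G := \matrix_(i < \dim {:RF F}, j < \dim {:RF F}) rdot e`_i e`_j.
have Gdot u w : rdot (passmx.vecof e u) (passmx.vecof e w)
    = (u *m G *m w^T) 0 0.
  rewrite /passmx.vecof rdot_suml -mulmxA mxE; apply: eq_bigr => i _.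
  rewrite mxE rdotC rdot_suml; congr (_ * _); apply: eq_bigr => j _.
  by rewrite !mxE rdotC mulrC.
have Te (i : 'I_(\dim {:RF F})) : T e`_i = passmx.vecof e (row i M).
  by rewrite -passmx.vecof_delta (passmx.hom_vecof _ eb) -/M -rowE.
have MGM : M *m G *m M^T = G.
  apply/matrixP=> i j; rewrite [RHS]mxE -(rdot_isometry nT) !Te Gdot.
  rewrite mxE [RHS]mxE; apply: eq_bigr => l _.
  by rewrite -row_mul !mxE.
(* A row killed by [G] gives the coordinates of a vector orthogonal to itself, hence zero. *)
have G0 : \det G != 0.
  apply/det0P => -[u u0 uG]; case/eqP: u0; apply/eqP.
  rewrite -(passmx.vecof_eq0 eb); apply/eqP/rdot_eq0.
  by rewrite Gdot uG mul0mx mxE.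
apply: (mulIf G0); rewrite mul1r -[in RHS]MGM !det_mulmx det_tr; ring.
Qed.

End NormPreserving.

(** * Conjugation by a unitary matrix as an isometry *)

Section UnitaryConjugation.
Variables (R : realType) (F : conjAlgType R).
Implicit Types (A B X : 'M[F]_2) (w : RF F) (t : R).

Definition funitary A := A *m adjmx A = 1%:M /\ adjmx A *m A = 1%:M.

Lemma funitary_mul A B : funitary A -> funitary B -> funitary (A *m B).
Proof.
move=> [A1 A2] [B1 B2]; split; rewrite adjmxM mulmxA.
  by rewrite -(mulmxA A) B1 mulmx1.
by rewrite -(mulmxA (adjmx B)) A2 mulmx1.
Qed.

Lemma funitary_adj A : funitary A -> funitary (adjmx A).
Proof. by case=> A1 A2; split; rewrite adjmxK. Qed.

(** Over the quaternions only the real part of the trace is cyclic; this suffices because a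
    Hermitian matrix has real trace. *)
Lemma conj_herm0 A X : funitary A -> herm0 X -> herm0 (A *m X *m adjmx A).
Proof.
move=> [_ A2] /andP[/eqP hX /eqP tX].
have h : adjmx (A *m X *m adjmx A) = A *m X *m adjmx A.
  by rewrite !adjmxM adjmxK hX mulmxA.
apply/andP; split; apply/eqP => //.
by rewrite (trace_fixed h) fre_traceC mulmxA A2 mul1mx tX linear0 scale0r.
Qed.

(** Real scalars are central even when [F] is not commutative. *)
Lemma mulmx_scalarr m n l (M : 'M[F]_(m, n)) t (N : 'M[F]_(n, l)) :
  M *m (t%:A *: N) = t%:A *: (M *m N).
Proof.
apply/matrixP=> i j; rewrite !mxE mulr_sumr; apply: eq_bigr => h _.
by rewrite !mxE !mulr_algl scalerAr.
Qed.

Lemma hpi_inv_mx_linear t w w' :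
  hpi_inv_mx (t *: w + w') = t%:A *: hpi_inv_mx w + hpi_inv_mx w'.
Proof.
apply/matrixP=> -[[|[|//]] hi] [[|[|//]] hj]; rewrite !mxE /= mulr_algl.
- by rewrite scalerDl scalerA.
- by [].
- by rewrite linearP.
- by rewrite scalerDl opprD scalerN scalerA.
Qed.

(** The formula of [hpi] on all matrices, so that [conj_RF A] is defined and linear for every
    [A]. *)
Definition hpi_mx X : RF F := (fre (X 0 0), X 0 1).

Lemma hpi_mxK X : herm0 X -> hpi_inv_mx (hpi_mx X) = X.
Proof. by move=> hX; have /(congr1 (@H20_val R F)) := hpiK (MkH20 hX). Qed.

Definition conj_RF A w : RF F := hpi_mx (A *m hpi_inv_mx w *m adjmx A).

Lemma conj_RF_linear A : linear (conj_RF A).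
Proof.
move=> t w w'; rewrite /conj_RF hpi_inv_mx_linear mulmxDr mulmx_scalarr.
rewrite mulmxDl -scalemxAl /hpi_mx.
set X := _ *m _ *m _; set Y := _ *m _ *m _.
rewrite !mxE !mulr_algl; congr (_, _).
by rewrite linearP.
Qed.
HB.instance Definition _ A :=
  GRing.isLinear.Build R (RF F) (RF F) _ (conj_RF A) (conj_RF_linear A).

Definition conj_lfun A : 'End(RF F) := linfun (conj_RF A).

Lemma conj_lfunE A w : conj_lfun A w = conj_RF A w.
Proof. by rewrite lfunE. Qed.

(** Unitarity of [B] keeps the inner conjugate traceless Hermitian, so passing through [hpi_mx] and
    back loses nothing. *)
Lemma conj_lfunM A B :
  funitary B -> conj_lfun (A *m B) = (conj_lfun A \o conj_lfun B)%VF.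
Proof.
move=> uB; apply/lfunP=> w; rewrite comp_lfunE !conj_lfunE.
rewrite {2}/conj_RF hpi_mxK; last exact: conj_herm0 (hpi_inv_herm0 w).
by rewrite /conj_RF adjmxM !mulmxA.
Qed.

(** A traceless Hermitian matrix squares to its squared norm times the identity. Norm preservation
    thus becomes invariance of a real trace. *)
Lemma RFnorm_trace w :
  RFnorm w ^+ 2 = fre (\tr (hpi_inv_mx w *m hpi_inv_mx w)) / 2.
Proof.
rewrite /RFnorm sqr_sqrtr ?addr_ge0 ?sqr_ge0 // fnormE real_normK ?num_real //.
rewrite /mxtrace big_ord_recl big_ord1 !mxE !big_ord_recl !big_ord0 !mxE /=.
rewrite mulrNN !scalarAM !linearD /= !fre_scalar linear0 (freC (fconj _)) expr2.
by lra.
Qed.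

Lemma conj_lfun_norm A w : funitary A -> RFnorm (conj_lfun A w) = RFnorm w.
Proof.
move=> uA; apply/eqP; rewrite -(@eqrXn2 _ 2) ?sqrtr_ge0 // !RFnorm_trace.
rewrite conj_lfunE hpi_mxK; last exact: conj_herm0 (hpi_inv_herm0 w).
set X := hpi_inv_mx w; case: uA => _ A2.
have -> : A *m X *m adjmx A *m (A *m X *m adjmx A) = A *m (X *m X *m adjmx A).
  by rewrite -!mulmxA (mulmxA (adjmx A) A) A2 mul1mx.
by rewrite fre_traceC -!mulmxA A2 mulmx1.
Qed.

Lemma conj_lfun_det_sqr A : funitary A -> lfun_det (conj_lfun (A *m A)) = 1.
Proof.
move=> uA; rewrite conj_lfunM // lfun_detM -expr2 isometry_det // => w.
exact: conj_lfun_norm.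
Qed.

(** The term [v *m adjmx v] is conjugated directly; its trace is real, so it is invariant under the
    conjugation and commutes past [A]. *)
Lemma conj_hopf_mx A v :
  funitary A -> hopf_mx (A *m v) = A *m hopf_mx v *m adjmx A.
Proof.
move=> [A1 A2]; have vv : adjmx (v *m adjmx v) = v *m adjmx v.
  by rewrite adjmxM adjmxK.
have AvE : A *m v *m adjmx (A *m v) = A *m (v *m adjmx v) *m adjmx A.
  by rewrite adjmxM !mulmxA.
have h : adjmx (A *m v *m adjmx (A *m v)) = A *m v *m adjmx (A *m v).
  by rewrite adjmxM adjmxK.
rewrite /hopf_mx mulmxBr mulmxBl -AvE; congr (_ - _).
have -> : \tr (A *m v *m adjmx (A *m v)) = \tr (v *m adjmx v).
  by rewrite (trace_fixed h) (trace_fixed vv) AvE fre_traceC mulmxA A2 mul1mx.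
rewrite (trace_fixed vv) scalerA -scalemx1 mulmx_scalarr mulmx1 -scalemxAl A1.
by [].
Qed.

End UnitaryConjugation.

(** * Rotations, diagonal matrices and the unitary factorization *)

Lemma half_angle (R : realType) (x y : R) : x ^+ 2 + y ^+ 2 = 1 ->
  exists c s : R, [/\ c ^+ 2 + s ^+ 2 = 1, x = c ^+ 2 - s ^+ 2 & y = 2 * c * s].
Proof.
move=> xy; have x2 : x ^+ 2 <= 1 by rewrite -xy lerDl sqr_ge0.
(* With x = cos t and y = sin t, the witnesses are a half-angle cosine and sine. At x = -1 that
   cosine vanishes, so [y / (2 * c)] cannot give the sine. *)
have [x1|x1] := eqVneq (1 + x) 0.
  have xE : x = -1 by lra.
  have /eqP : y ^+ 2 = 0 by rewrite xE in xy; lra.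
  by rewrite sqrf_eq0 xE => /eqP->; exists 0, 1; split; ring.
have x_ge : 0 <= (1 + x) / 2.
  by have := sqr_ge0 (1 + x); rewrite !expr2 in x2 xy *; nra.
set c := Num.sqrt ((1 + x) / 2).
have cE : c ^+ 2 = (1 + x) / 2 by rewrite sqr_sqrtr.
have c0 : c != 0.
  by rewrite -sqrf_eq0 cE mulf_neq0 ?invr_eq0 ?pnatr_eq0.
have sE : (y / (2 * c)) ^+ 2 = (1 - x) / 2.
  rewrite expr_div_n exprMn cE; have -> : y ^+ 2 = 1 - x ^+ 2 by lra.
  by field.
exists c, (y / (2 * c)); rewrite cE sE; split; [by field|by field|].
by field.
Qed.

Section Factorization.
Variables (R : realType) (F : conjAlgType R).
Implicit Types (a b c d p q z : F) (A : 'M[F]_2) (x y : R).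

Definition mx2 a b c d : 'M[F]_2 :=
  \matrix_(i, j) if i == 0 then (if j == 0 then a else b)
                 else (if j == 0 then c else d).

Lemma mx2_eta A : A = mx2 (A 0 0) (A 0 1) (A 1 0) (A 1 1).
Proof.
apply/matrixP=> -[[|[|//]] hi] [[|[|//]] hj]; rewrite !mxE /=;
  by congr (A _ _); apply: val_inj.
Qed.

Lemma mulmx2 a b c d a' b' c' d' :
  mx2 a b c d *m mx2 a' b' c' d' =
  mx2 (a * a' + b * c') (a * b' + b * d') (c * a' + d * c') (c * b' + d * d').
Proof.
by apply/matrixP=> -[[|[|//]] hi] [[|[|//]] hj];
  rewrite !mxE /= !big_ord_recl !big_ord0 !mxE /= addr0.
Qed.

Lemma adjmx2 a b c d :
  adjmx (mx2 a b c d) = mx2 (fconj a) (fconj c) (fconj b) (fconj d).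
Proof. by apply/matrixP=> -[[|[|//]] hi] [[|[|//]] hj]; rewrite !mxE. Qed.

Lemma mx2_1 : mx2 1 0 0 1 = 1%:M.
Proof. by apply/matrixP=> -[[|[|//]] hi] [[|[|//]] hj]; rewrite !mxE. Qed.

Lemma mx2_inj a b c d a' b' c' d' : mx2 a b c d = mx2 a' b' c' d' ->
  [/\ a = a', b = b', c = c' & d = d'].
Proof.
move/matrixP=> h.
by split; [move: (h 0 0)|move: (h 0 1)|move: (h 1 0)|move: (h 1 1)]; rewrite !mxE.
Qed.

Definition diag2 p q := mx2 p 0 0 q.

Lemma diag2M p q p' q' : diag2 p q *m diag2 p' q' = diag2 (p * p') (q * q').
Proof. by rewrite mulmx2 !mulr0 !mul0r !addr0 !add0r. Qed.

Lemma adj_diag2 p q : adjmx (diag2 p q) = diag2 (fconj p) (fconj q).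
Proof. by rewrite adjmx2 linear0. Qed.

Lemma funitary_diag2 p q : funit p -> funit q -> funitary (diag2 p q).
Proof.
by move=> [p1 p2] [q1 q2]; split; rewrite adj_diag2 diag2M (p1, p2) (q1, q2) /diag2 mx2_1.
Qed.

Definition rot2 x y := mx2 x%:A (- y%:A) y%:A x%:A.

Lemma rot2M x y x' y' :
  rot2 x y *m rot2 x' y' = rot2 (x * x' - y * y') (y * x' + x * y').
Proof.
rewrite /rot2 mulmx2 !mulrN !mulNr !scalarAM -!scaleNr -!scalerDl.
by congr mx2; congr (_ *: _); ring.
Qed.

Lemma adj_rot2 x y : adjmx (rot2 x y) = rot2 x (- y).
Proof. by rewrite adjmx2 linearN /= !fconj_real /rot2 scaleNr opprK. Qed.

Lemma rot2_1 : rot2 1 0 = 1%:M.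
Proof. by rewrite /rot2 scale1r scale0r oppr0 mx2_1. Qed.

Lemma funitary_rot2 x y : x ^+ 2 + y ^+ 2 = 1 -> funitary (rot2 x y).
Proof.
move=> xy; have xy' : x * x + y * y = 1 by rewrite -!expr2.
split; rewrite adj_rot2 rot2M -rot2_1; congr rot2; rewrite -?xy'; ring.
Qed.

Lemma conj_rot2_det x y :
  x ^+ 2 + y ^+ 2 = 1 -> lfun_det (conj_lfun (rot2 x y)) = 1.
Proof.
move=> /half_angle[c [s [cs xE yE]]].
have -> : rot2 x y = rot2 c s *m rot2 c s.
  by rewrite rot2M; congr rot2; rewrite ?xE ?yE; ring.
exact/conj_lfun_det_sqr/funitary_rot2.
Qed.

(** The polar forms of the two entries of the first column supply [p], [q], [x] and [y]. Undoing
    these factors leaves a unitary matrix with first column (1, 0), which must be diagonal. *)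
Lemma funitary_factor A : funitary A ->
  exists p q z x y, [/\ funit p, funit q, funit z, x ^+ 2 + y ^+ 2 = 1
    & A = diag2 p q *m rot2 x y *m diag2 1 z].
Proof.
move=> uA; set a := A 0 0; set c := A 1 0.
have [p pu aE] := fpolar a; have [q qu cE] := fpolar c.
set x := fnorm a in aE; set y := fnorm c in cE.
have AE : A = mx2 a (A 0 1) c (A 1 1) by exact: mx2_eta.
(* Entry (0, 0) of [adjmx A *m A = 1%:M]: the first column has norm 1. *)
have xy : x ^+ 2 + y ^+ 2 = 1.
  have [_] := uA; rewrite {1 2}AE adjmx2 mulmx2 -mx2_1 => /mx2_inj[h _ _ _].
  by rewrite !fnormE -[LHS](fre_scalar F) scalerDl -!conj_mul h fre1.
set D := diag2 p q; have uD : funitary D by exact: funitary_diag2.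
set Q := rot2 x y; have uQ : funitary Q by exact: funitary_rot2.
pose W := adjmx Q *m (adjmx D *m A).
have uW : funitary W.
  by do 2?apply: funitary_mul => //; exact: funitary_adj.
have AW : A = D *m Q *m W.
  case: uD uQ => D1 _ [Q1 _].
  by rewrite /W mulmxA -(mulmxA D) Q1 mulmx1 mulmxA D1 mul1mx.
(* [adjmx D] strips the phases from the first column, leaving (x, y), which [adjmx Q] rotates to (1,
   0). *)
have [b [z WE]] : exists b z, W = mx2 1 b 0 z.
  have DA : adjmx D *m A = mx2 x%:A (fconj p * A 0 1) y%:A (fconj q * A 1 1).
    case: pu qu => _ p1 [_ q1].
    rewrite {1}AE adj_diag2 mulmx2 !mul0r !addr0 !add0r aE cE -!scalerAr.
    by rewrite p1 q1.
  exists (W 0 1), (W 1 1); rewrite {1}(mx2_eta W).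
  congr mx2; rewrite /W DA adj_rot2 mulmx2 mxE /= ?scaleNr ?opprK !scalarAM.
    by rewrite -scalerDl -!expr2 xy scale1r.
  by rewrite mulNr scalarAM mulrC addNr.
(* Entry (0, 1) of [adjmx W *m W] is [b] itself. *)
have [b0 zu] : b = 0 /\ funit z.
  case: uW; rewrite WE adjmx2 !mulmx2 -mx2_1 fconj1 linear0.
  rewrite !mulr0 !mul0r !mulr1 !mul1r !addr0 !add0r.
  move=> /mx2_inj[_ _ _ z1] /mx2_inj[_ b0 _ z2]; split=> //; split=> //.
  by rewrite -z2 b0 mulr0 add0r.
exists p, q, z, x, y; split=> //.
by rewrite AW WE b0.
Qed.

(** An imaginary unit [i] exists over C and H but not over R. It makes both diagonal factors squares
    of unitary diagonal matrices. *)
Lemma conj_lfun_det (i : F) A : i * i = -1 -> fconj i = - i ->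
  funitary A -> lfun_det (conj_lfun A) = 1.
Proof.
move=> ii ci /funitary_factor[p [q [z [x [y [pu qu zu xy ->]]]]]].
have detD r s : funit r -> funit s -> lfun_det (conj_lfun (diag2 r s)) = 1.
  move=> /(funit_sqrt ii ci)[r' ru ->] /(funit_sqrt ii ci)[s' su ->].
  by rewrite -diag2M; apply/conj_lfun_det_sqr/funitary_diag2.
have uz : funitary (diag2 1 z) by apply: funitary_diag2 => //; exact: funit1.
rewrite conj_lfunM // conj_lfunM; last exact: funitary_rot2.
rewrite !lfun_detM conj_rot2_det // !detD // ?mulr1 //; exact: funit1.
Qed.

End Factorization.

(** * The homomorphism from SU(2, F) to SO(R + F) *)

Lemma SU2_funitary (R : realType) (k : base) (A : SU2 R k) : funitary A.
Proof. by case/and3P: (su2P A) => /eqP A1 /eqP A2 _. Qed.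

Lemma conj_lfun_det_real (R : realType) (A : SU2 R RealBase) :
  lfun_det (conj_lfun A) = 1.
Proof.
have [uA _] := SU2_funitary A; case/and3P: (su2P A) => _ _ /eqP /=.
move: uA; set B := su2_val A.
(* The determinant is read over [R] itself, so that it becomes an identity between real numbers. *)
rewrite -[\det _]/(\det (B : 'M[R]_2)) (expand_det_row _ 0) !big_ord_recl big_ord0.
rewrite /cofactor !det_mx11 !mxE (mx2_eta B) adjmx2 mulmx2 -mx2_1 => /mx2_inj[].
rewrite !mxE /= expr0 expr1.
move: (B 0 0 : R) (B 0 1 : R) (B 1 0 : R) (B 1 1 : R) => a b c d.
move=> ab' acbd' _ _; rewrite mul1r mulN1r addr0 mulrN => ad.
have {ab'}ab : a * a + b * b = 1 by exact: ab'.
have {acbd'}acbd : a * c + b * d = 0 by exact: acbd'.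
(* Orthonormality and determinant 1 force the second row to be (-b, a), which makes the matrix a
   rotation. *)
have dE : d = a.
  transitivity (d * (a * a + b * b)); first by rewrite ab mulr1.
  transitivity (a * (a * d - b * c) + b * (a * c + b * d)); first by ring.
  by rewrite ad acbd; ring.
have bE : b = - c.
  transitivity (b * (a * d - b * c)); first by rewrite ad mulr1.
  transitivity (d * (a * b) - c * (b * b)); first by ring.
  have -> : b * b = 1 - a * a by rewrite -ab; ring.
  transitivity (a * (a * c + b * d) - c); first by ring.
  by rewrite acbd; ring.
have -> : @mx2 R (scalars R RealBase) a b c d = rot2 (scalars R RealBase) a c.
  by rewrite dE bE /rot2 /GRing.scale /= !mulr1.
by apply: conj_rot2_det; rewrite -ab bE; ring.
Qed.

Lemma SU2_conj_det (R : realType) (k : base) (A : SU2 R k) :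
  lfun_det (conj_lfun A) = 1.
Proof.
have := SU2_funitary A; case: k A => A uA; first exact: conj_lfun_det_real.
  apply: (@conj_lfun_det _ _ (Complex 0 1 : Rcomplex R)) => //.
    by apply/eqP; rewrite eq_complex /=; apply/andP; split; apply/eqP; ring.
  by apply/eqP; rewrite eq_complex /=; apply/andP; split; apply/eqP; ring.
apply: (@conj_lfun_det _ _ (Quat 0 1 0 0 : quat R)) => //.
  by congr Quat; rewrite /=; ring.
by congr Quat; rewrite /=; ring.
Qed.

Lemma SU2_so_pred (R : realType) (k : base) (A : SU2 R k) :
  so_pred (conj_lfun A).
Proof.
rewrite /so_pred SU2_conj_det eqxx andbT; apply/asboolP=> w.
exact/conj_lfun_norm/SU2_funitary.
Qed.

Definition SU2_SO (R : realType) (k : base) (A : SU2 R k) : SORF (scalars R k) :=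
  MkSORF (SU2_so_pred A).

Lemma SU2_SO_multiplicative (R : realType) (k : base) :
  {morph @SU2_SO R k : A B / (A * B)%g}.
Proof.
by move=> A B; apply: val_inj; rewrite /= conj_lfunM //; exact: SU2_funitary.
Qed.
HB.instance Definition _ (R : realType) (k : base) :=
  isMultiplicative.Build (SU2 R k) (SORF (scalars R k)) (@SU2_SO R k)
    (@SU2_SO_multiplicative R k).

Theorem proposition20 (R : realType) (k : base) :
  (forall (A : SU2 R k) (v : 'cV[scalars R k]_2),
      hopf (std_act A v) = conj_act A (hopf v)) /\
  (exists T : {multiplicative SU2 R k -> SORF (scalars R k)},
      forall (A : SU2 R k) (v : 'cV[scalars R k]_2),
        hpi (hopf (std_act A v)) = T A (hpi (hopf v))).
Proof.
split=> [A v|].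
  by apply: val_inj; apply: conj_hopf_mx; exact: SU2_funitary.
(* [hpi_mxK] recovers the matrix of [hopf v] from its image, which reduces the claim to
   equivariance. *)
exists (@SU2_SO R k) => A v; rewrite /= conj_lfunE /conj_RF hpi_mxK.
  by rewrite /hpi /= conj_hopf_mx //; exact: SU2_funitary.
exact: hopf_herm0.
Qed.
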